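(* Let $\mathbb{K}$ be a Galois number field of degree $n$, let $G=\operatorname{Gal}(\mathbb{K}/\mathbb{Q})$, let $M$ be a $\mathbb{Z}$-submodule of $\mathbb{K}$ (not necessarily of rank $n$), and let $G_M=\{\tau|_M : \tau\in G\}$. Then the lattice $\Lambda=\sigma(M)$ is cyclic (for a suitable ordering $\sigma_1,\dots,\sigma_n$ of the elements of $G$ in the definition of the Minkowski embedding $\sigma$) if and only if $G_M$ is a cyclic group.
   Context: The Galois number field $\mathbb{K}$ (i.e. $\mathbb{K}/\mathbb{Q}$ is a finite Galois extension) is regarded as a subfield of $\mathbb{C}$, and its $n$ embeddings into $\mathbb{C}$ are identified with the elements of $G$. Given an ordering $\sigma_1,\dots,\sigma_n$ of the elements of $G$, the Minkowski embedding is $\sigma:\mathbb{K}\to\mathbb{C}^n$, $\sigma(x)=(\sigma_1(x),\dots,\sigma_n(x))$. The $\mathbb{Z}$-submodules $M$ considered are finitely generated, so that $\sigma(M)$ is a lattice. The shift operator is $\rho(c_1,\dots,c_n)=(c_n,c_1,\dots,c_{n-1})$ on $\mathbb{C}^n$, and $\Lambda$ is cyclic if $\rho(\Lambda)=\Lambda$. Here $\tau|_M$ denotes the restriction of $\tau$ to $M$, a map $M\to\mathbb{K}$. Saying that $G_M$ is a (cyclic) group means that composition is a well-defined operation on $G_M$ (for all $\tau,\tau'\in G$ one has $\tau'(M)\subseteq M$, so that $\tau|_M\circ\tau'|_M$ makes sense, and this composite lies in $G_M$) which makes $G_M$ a (cyclic) group. *)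

(* Defs.v *)
From HB Require Import structures.
From mathcomp Require Export all_boot all_order all_fingroup all_algebra.
From mathcomp Require Export all_solvable all_field.
From mathcomp Require Export boolp classical_sets reals complex.

Set Implicit Arguments.
Unset Strict Implicit.
Unset Printing Implicit Defensive.

Import GRing.Theory Num.Theory.

Local Open Scope ring_scope.
Local Open Scope classical_set_scope.

Definition finitely_generated (V : zmodType) (M : {pred V}) : Prop :=
  exists (m : nat) (X : m.-tuple V), forall v : V, v \in M <-> inIntSpan X v.

Section Minkowski.

Variables (C : fieldType) (K : splittingFieldType rat).

(* An ordering sigma_1, ..., sigma_n of the elements of Gal(K / Q). *)
Definition gal_ordering (n : nat) (s : n.-tuple (gal_of {:K})) : Prop :=
  uniq s /\ s =i 'Gal({:K} / 1)%g.

(* [iota] plays the role of the inclusion of K in the complex numbers: the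
   automorphism tau is identified with the embedding [iota \o tau]. *)
Definition minkowski (iota : {rmorphism K -> C}) (n : nat)
    (s : n.-tuple (gal_of {:K})) (x : K) : 'rV[C]_n :=
  \row_(i < n) iota (tnth s i x).

End Minkowski.

(* (c_1, ..., c_n) is sent to (c_n, c_1, ..., c_(n-1)): [ord_pred] is the
   predecessor modulo n, which maps the first index to the last one. *)
Definition shift (C : Type) (n : nat) (c : 'rV[C]_n) : 'rV[C]_n :=
  \row_(i < n) c ord0 (ord_pred i).

Definition cyclic_lattice (C : Type) (n : nat) (Lambda : set 'rV[C]_n) : Prop :=
  [set shift c | c in Lambda] = Lambda.

Section Restriction.

Variables (K : splittingFieldType rat) (M : {pred K}).

Definition gal_restr (tau : gal_of {:K}) : {x : K | x \in M} -> K :=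
  fun x => tau (val x).

Definition gal_restr_set : set ({x : K | x \in M} -> K) :=
  [set gal_restr tau | tau in [set` 'Gal({:K} / 1)%g]].

(* [h] is the composite of [f] and [g]; this requires [g] to take its values
   in M, the domain of [f]. *)
Definition is_composite (f g h : {x : K | x \in M} -> K) : Prop :=
  forall x, exists2 y : {x : K | x \in M}, val y = g x & h x = f y.

End Restriction.

Arguments gal_restr_set {K} M _.

(* The set A of maps from M to K is a cyclic group under composition: there is
   a group structure on A itself whose product is composition (all the
   composites being defined, see [is_composite]), and it is cyclic.  Only
   finite groups are considered, which is no restriction for the finite set
   of restrictions of elements of a Galois group. *)
Definition cyclic_group_of_maps (K : splittingFieldType rat) (M : {pred K})
    (A : set ({x : K | x \in M} -> K)) : Prop :=
  exists structure : FinGroup {f | A f},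
    let gT : finGroupType := FinGroup.Pack structure in
    (forall f g : gT, is_composite (sval f) (sval g) (sval (f * g)%g))
    /\ cyclic [set: gT]%SET.

(* Main.v *)
(** Let N be the pointwise stabilizer of M in G.  Once M is stable under G, the
    subgroup N is normal and G_M is a copy of G / N, so both sides of the
    equivalence amount to: M is G-stable and G / N is cyclic.

    If the lattice is cyclic, then t = sigma_1^-1 sigma_n maps M into M and
    sigma_i t = sigma_(i-1) on M for every i.  Hence
    sigma_i t^k = sigma_(i-k) on M (indices modulo n); choosing k with
    sigma_(i-k) = 1 shows that sigma_i^-1 agrees on M with a power of t.

    Conversely, if c generates G / N, of order m, lift c to t in G and list G
    as t^(i mod m) d_(i / m), where d enumerates N: the i-th automorphism
    lies over c^i, and since m divides n this remains true cyclically, so the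
    shift acts on the lattice as t^-1 acts on M. *)

From HB Require Import structures.
Require Import Defs.

Import GRing.Theory.

Set Implicit Arguments.
Unset Strict Implicit.
Unset Printing Implicit Defensive.

Local Open Scope ring_scope.
Local Open Scope classical_set_scope.

(** * Transport of a finite group structure along a bijection *)

Section TransportFinGroup.

Variables (T : Type) (gT : finGroupType) (f : T -> gT) (g : gT -> T).
Hypotheses (fK : cancel f g) (gK : cancel g f).

HB.instance Definition _ := isFinite.Build (can_type fK)
  (@pcan_enumP (can_type fK) gT f _ (can_pcan fK)).

Definition transport_mul (x y : can_type fK) : can_type fK := g (f x * f y)%g.
Definition transport_one : can_type fK := g 1%g.
Definition transport_inv (x : can_type fK) : can_type fK := g (f x)^-1%g.

Fact transport_mulA : associative transport_mul.
Proof. by move=> x y z; rewrite /transport_mul !gK mulgA. Qed.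

Fact transport_mul1g : left_id transport_one transport_mul.
Proof. by move=> x; rewrite /transport_mul gK mul1g fK. Qed.

Fact transport_mulVg :
  left_inverse transport_one transport_inv transport_mul.
Proof. by move=> x; rewrite /transport_mul gK mulVg. Qed.

HB.instance Definition _ := Finite_isGroup.Build (can_type fK)
  transport_mulA transport_mul1g transport_mulVg.

(** [cyclic_group_of_maps] wants a group structure on the set of maps itself, not on an isomorphic
    copy; the law of [gT] is pulled back along [f], and [g] carries a generator over. *)
Lemma transport_fingroup :
  exists st : FinGroup T, let hT : finGroupType := FinGroup.Pack st in
    (forall x y : hT, f (x * y)%g = (f x * f y)%g)
    /\ (cyclic [set: gT]%SET -> cyclic [set: hT]%SET).
Proof.
exists (FinGroup.class (can_type fK)) => /=.
set hT := FinGroup.Pack _.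
have fM (x y : hT) : f (x * y)%g = (f x * f y)%g by exact: gK.
split=> // /cyclicP[c cE].
have f1 : f (1%g : hT) = 1%g by exact: gK.
have fX (x : hT) k : f (x ^+ k)%g = (f x ^+ k)%g.
  by elim: k => [|k IHk] //; rewrite !expgS fM IHk.
apply/cyclicP; exists (g c : hT); apply/esym/setP => x; rewrite [RHS]inE.
have /cycleP[k fx] : f x \in <[c]>%g by rewrite -cE inE.
by apply/cycleP; exists k; rewrite -[LHS]fK -[RHS]fK fX gK fx.
Qed.

End TransportFinGroup.

(** * The pointwise stabilizer N of M and the quotient G / N *)

Section GaloisStabilizer.

Variables (K : splittingFieldType rat) (M : {pred K}).
Implicit Types (a b t : gal_of {:K}) (x y : K).

Lemma gal_setT : 'Gal({:K} / 1)%g = [set: gal_of {:K}]%SET.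
Proof.
by apply/setP=> t; rewrite inE gal_kHom ?sub1v // k1HomE ahomWin.
Qed.

Lemma galMT a b x : (a * b)%g x = b (a x).
Proof. exact/galM/memvf. Qed.

Definition gal_stable := forall t x, x \in M -> t x \in M.

Definition gal_fix : {set gal_of {:K}} :=
  [set t : gal_of {:K} | `[< forall x, x \in M -> t x = x >]]%SET.

Lemma gal_fixP t : reflect (forall x, x \in M -> t x = x) (t \in gal_fix).
Proof. by rewrite inE; exact: asboolP. Qed.

Fact gal_fix_group_set : group_set gal_fix.
Proof.
apply/group_setP; split=> [|a b /gal_fixP fixa /gal_fixP fixb].
  by apply/gal_fixP=> x _; rewrite gal_id.
by apply/gal_fixP=> x Mx; rewrite galMT fixa ?fixb.
Qed.
Canonical gal_fix_group := Group gal_fix_group_set.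

Hypothesis stM : gal_stable.

(** A conjugate of [a] sends [x] to [t (a (t^-1 x))]; stability puts [t^-1 x] in M, where [a] acts
    trivially. *)
Lemma gal_fix_norm t : t \in 'N(gal_fix)%g.
Proof.
rewrite inE; apply/fintype.subsetP => _ /imsetP[a /gal_fixP fixa ->].
apply/gal_fixP=> x Mx; rewrite conjgE !galMT fixa; last exact: stM.
by rewrite -galMT mulVg gal_id.
Qed.

Lemma coset_gal_fixP a b :
  (forall x, x \in M -> a x = b x) <-> coset gal_fix a = coset gal_fix b.
Proof.
split=> [eqab|/(rcoset_kercosetP (gal_fix_norm a) (gal_fix_norm b))].
  apply/(rcoset_kercosetP (gal_fix_norm a) (gal_fix_norm b)).
  rewrite mem_rcoset; apply/gal_fixP => x Mx.
  by rewrite galMT eqab // -galMT mulgV gal_id.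
rewrite mem_rcoset => /gal_fixP fixab x Mx.
by rewrite -[in RHS](fixab x Mx) -galMT mulgKV.
Qed.

Lemma coset_gal_restrP a b :
  gal_restr (M := M) a = gal_restr b <-> coset gal_fix a = coset gal_fix b.
Proof.
rewrite -coset_gal_fixP; split=> [eqab x Mx|eqab].
  exact: (congr1 (fun f => f (exist _ x Mx)) eqab).
by apply/funext => -[x Mx]; exact: eqab.
Qed.

(** Cyclicity of G / N in terms of the action on M alone, the form in which both sides of the
    equivalence deliver it. *)
Lemma cyclic_gal_quotientP :
  cyclic [set: coset_of gal_fix]%SET <->
  exists t, forall a, exists k, forall x, x \in M -> a x = (t ^+ k)%g x.
Proof.
split=> [/cyclicP[c cE]|[t genM]].
  exists (repr c) => a.
  have /cycleP[k ak] : coset gal_fix a \in <[c]>%g by rewrite -cE inE.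
  exists k; apply/coset_gal_fixP.
  by rewrite ak morphX ?gal_fix_norm //= coset_reprK.
apply/cyclicP; exists (coset gal_fix t); apply/esym/setP => c; rewrite [RHS]inE.
have [k /coset_gal_fixP tk] := genM (repr c).
apply/cycleP; exists k.
by rewrite -[LHS]coset_reprK tk morphX ?gal_fix_norm.
Qed.

End GaloisStabilizer.

(** * Identification of G_M with G / N *)

Section RestrictionGroup.

Variables (K : splittingFieldType rat) (M : {pred K}).
Implicit Types (a b t : gal_of {:K}) (x y : K).

Lemma gal_restr_setP a : gal_restr_set M (gal_restr a).
Proof. by exists a => //=; rewrite gal_setT inE. Qed.

Lemma cyclic_group_of_mapsP :
  cyclic_group_of_maps (gal_restr_set M) <->
  gal_stable M /\ cyclic [set: coset_of (gal_fix M)]%SET.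
Proof.
split=> [[st [/= compM /cyclicP[g gE]]]|[stM cycM]].
  set gT := FinGroup.Pack st in compM g gE.
  pose r a : gT := exist _ _ (gal_restr_setP a).
  have stM : gal_stable M.
    move=> a x Mx; have [y y_ax _] := compM (r a) (r a) (exist _ x Mx).
    by have := valP y; rewrite y_ax.
  (* In the Galois group [a * b] applies [a] first, so restriction reverses products; powers are
     unaffected. *)
  have rM a b : r (a * b)%g = (r b * r a)%g.
    have := compM (r b) (r a); case: (r b * r a)%g => h Ah /= comp_h.
    apply/eq_exist/funext => x; have [y y_ax ->] := comp_h x.
    by rewrite /gal_restr y_ax galMT.
  have r1 : r 1%g = 1%g by apply: (mulgI (r 1%g)); rewrite -rM !mulg1.
  have rX a k : r (a ^+ k)%g = (r a ^+ k)%g.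
    by elim: k => [|k IHk]; rewrite ?expg0 ?r1 // expgS expgSr rM IHk.
  split=> //; apply/cyclic_gal_quotientP => //.
  have [t rt] : exists t, r t = g.
    by case: (g) => h [t At th]; exists t; exact: eq_exist.
  exists t => a.
  have /cycleP[k ak] : r a \in <[r t]>%g by rewrite rt -gE inE.
  exists k; apply/coset_gal_fixP/coset_gal_restrP => //.
  by move: ak; rewrite -rX => /(congr1 sval).
pose lift (f : {f | gal_restr_set M f}) := s2val (cid2 (svalP f)).
have liftK f : gal_restr (lift f) = sval f by exact: s2valP' (cid2 (svalP f)).
(* [F] and [H] are inverse bijections between G_M and G / N. *)
pose F f := coset (gal_fix M) (lift f).
pose H (c : coset_of (gal_fix M)) : {f | gal_restr_set M f} :=
  exist _ _ (gal_restr_setP (repr c)).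
have FK : cancel F H.
  move=> [f Af]; apply: eq_exist; rewrite -[RHS](liftK (exist _ f Af)).
  by apply/coset_gal_restrP => //; rewrite coset_reprK.
have HK : cancel H F.
  move=> c; apply: etrans (coset_reprK c).
  exact/(coset_gal_restrP stM)/liftK.
have [st /= [fM cycT]] := transport_fingroup FK HK.
exists st; split; last exact: cycT.
move=> f g [x Mx].
have gx : lift g x \in M by exact: stM.
exists (exist (fun z => z \in M) _ gx); first by rewrite -liftK.
rewrite -!liftK /gal_restr /= -galMT; move: x Mx {gx}.
apply/(coset_gal_fixP stM); rewrite -/(F _) fM.
rewrite morphM ?gal_fix_norm //=.
(* The transported law multiplies cosets in the order opposite to composition; a cyclic quotient is
   abelian, so the two agree. *)
have /centsP cc := cyclic_abelian cycM.
by rewrite cc ?inE.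
Qed.

End RestrictionGroup.

(** * Cyclic lattices and the quotient G / N *)

Section LatticeShift.

Variables (C : fieldType) (K : splittingFieldType rat).
Variables (iota : {rmorphism K -> C}) (M : {pred K}).

Lemma shift_minkowskiP n (s : n.-tuple (gal_of {:K})) (x y : K) :
  shift (minkowski iota s x) = minkowski iota s y <->
  forall i, tnth s (ord_pred i) x = tnth s i y.
Proof.
split=> [/rowP sxy i|sxy]; last by apply/rowP=> i; rewrite !mxE sxy.
by have := sxy i; rewrite !mxE => /fmorph_inj.
Qed.

(** Decrementing leads every index to 0, and orbits of an injective map on a finite set are cycles,
    so 0 leads back to [j]. *)
Lemma ord_pred_transitive n (i j : 'I_n) :
  exists k, iter k (@ord_pred n) i = j.
Proof.
case: n i j => [[]//|n] i j.
have to0 (l : 'I_n.+1) : fconnect (@ord_pred n.+1) l ord0.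
  case: l => m; elim: m => [|m IHm] ltmn.
    by rewrite (_ : Ordinal _ = ord0) //; exact: val_inj.
  apply: connect_trans (IHm (ltnW ltmn)).
  apply: connect1; apply/eqP/val_inj => /=.
  by rewrite modnDr modn_small // ltnW.
have ij : fconnect (@ord_pred n.+1) i j.
  apply: connect_trans (to0 i) _.
  by rewrite fconnect_sym ?to0 //; exact: ord_pred_inj.
by exists (findex (@ord_pred n.+1) i j); exact: iter_findex.
Qed.

Lemma cyclic_lattice_cyclic_quotient n (s : n.-tuple (gal_of {:K})) :
  gal_ordering s ->
  cyclic_lattice [set minkowski iota s x | x in [set` M]] ->
  gal_stable M /\ cyclic [set: coset_of (gal_fix M)]%SET.
Proof.
move=> [_ sE] cycL.
have s_tnth a : exists i, a = tnth s i.
  by apply/tnthP; rewrite sE gal_setT inE.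
have [j s_j] := s_tnth 1%g.
(* The [t] of the overview, with [j] as base index in place of 1. *)
pose t := (tnth s (ord_pred j) * (tnth s j)^-1)%g.
have s_t x i : x \in M -> t x \in M /\ tnth s i (t x) = tnth s (ord_pred i) x.
  move=> Mx.
  (* The shifted vector comes from some [y] in M; its coordinate [j] forces [y = t x], and the other
     coordinates give the second claim. *)
  have [y My] : [set minkowski iota s x | x in [set` M]]
      (shift (minkowski iota s x)).
    by rewrite -cycL; exists (minkowski iota s x) => //; exists x.
  move=> /esym/shift_minkowskiP sxy.
  have -> : t x = y by rewrite galMT sxy -galMT mulgV gal_id.
  by rewrite sxy.
have s_tX k x : x \in M ->
    (t ^+ k)%g x \in M /\
    forall i, tnth s i ((t ^+ k)%g x) = tnth s (iter k (@ord_pred n) i) x.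
  move=> Mx; elim: k => [|k [Mtx IHk]]; first by rewrite expg0 gal_id.
  rewrite expgSr galMT; split=> [|i]; first by have [] := s_t _ j Mtx.
  by have [_ ->] := s_t _ i Mtx; rewrite IHk -iterSr.
have genM (a : gal_of {:K}) : exists k, forall x, x \in M -> a x = (t ^+ k)%g x.
  (* Once [k] steps lead from [i] to [j], [a^-1 (t^k x) = x] on M, that is [a x = t^k x]. *)
  have [i si] := s_tnth a^-1%g.
  have [k ij] := ord_pred_transitive i j.
  exists k => x Mx; have [_ /(_ i)] := s_tX k x Mx.
  rewrite ij -s_j gal_id -si => {1}<-.
  by rewrite -galMT mulVg gal_id.
have stM : gal_stable M.
  by move=> a x Mx; have [k ->//] := genM a; have [] := s_tX k x Mx.
by split=> //; apply/cyclic_gal_quotientP => //; exists t.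
Qed.

Lemma card_gal_fix : gal_stable M ->
  #|[set: gal_of {:K}]%SET| =
  (#|gal_fix M| * #|[set: coset_of (gal_fix M)]%SET|)%N.
Proof.
move=> stM.
have normT : [set: gal_of {:K}]%SET \subset 'N(gal_fix M)%g.
  by apply/fintype.subsetP => a _; exact: gal_fix_norm.
have -> : [set: coset_of (gal_fix M)]%SET =
    ([set: gal_of {:K}]%SET / gal_fix M)%g.
  apply/esym/setP => c; rewrite [RHS]inE -[c]coset_reprK.
  by rewrite mem_quotient ?inE.
by rewrite card_quotient // Lagrange ?finset.subsetT.
Qed.

Lemma cyclic_quotient_cyclic_lattice n :
  #|[set: gal_of {:K}]%SET| = n ->
  gal_stable M -> cyclic [set: coset_of (gal_fix M)]%SET ->
  exists s : n.-tuple (gal_of {:K}), gal_ordering s /\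
    cyclic_lattice [set minkowski iota s x | x in [set` M]].
Proof.
move=> cardT stM /cyclicP[c cE].
have nE : n = (#|gal_fix M| * #[c]%g)%N by rewrite -cardT card_gal_fix // cE.
(* The default 1 is never reached: [i < n] keeps the quotient below the order of N, as [ltd]
   shows. *)
pose t := repr c; pose d (i : nat) := nth 1%g (enum (gal_fix M)) (i %/ #[c]%g).
pose s := [tuple ((t ^+ (i %% #[c]%g)) * d i)%g | i < n].
have ltd (i : 'I_n) : (i %/ #[c]%g < size (enum (gal_fix M)))%N.
  by rewrite ltn_divLR ?order_gt0 // -cardE -nE.
have s_c i : coset (gal_fix M) (tnth s i) = (c ^+ i)%g.
  rewrite tnth_mktuple morphM ?gal_fix_norm //= morphX ?gal_fix_norm //=.
  rewrite coset_reprK expg_mod_order [X in (_ * X)%g]coset_id ?mulg1 //.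
  by rewrite -mem_enum mem_nth.
have cn1 : (c ^+ n)%g = 1%g by rewrite nE mulnC expgM expg_order expg1n.
(* The coset of an entry determines [i] modulo the order of [c]; cancelling the power of [t] then
   leaves the element of N, which determines the quotient. *)
have s_inj : injective (tnth s).
  move=> i j eq_ij; have := s_c i; rewrite eq_ij s_c => /eqP.
  rewrite eq_expg_mod_order => /eqP eq_mod; move: eq_ij.
  rewrite !tnth_mktuple eq_mod => /mulgI/eqP.
  rewrite nth_uniq ?enum_uniq // => /eqP eq_div; apply/val_inj.
  by rewrite /= (divn_eq i #[c]%g) (divn_eq j #[c]%g) eq_mod eq_div.
exists s; split.
  split=> [|a]; first exact/tuple_uniqP.
  have /codomP[i ->] : a \in codom (tnth s).
    by apply: inj_card_onto => //; rewrite card_ord -cardT cardsT.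
  by rewrite mem_tnth gal_setT inE.
have tV x i : x \in M -> tnth s (ord_pred i) x = tnth s i (t^-1%g x).
  rewrite -galMT; move: x; apply/(coset_gal_fixP stM).
  rewrite morphM ?gal_fix_norm //= morphV ?gal_fix_norm //= coset_reprK !s_c.
  (* The successor of [ord_pred i] is [i] only modulo [n]; [cn1] absorbs the wrap-around at the
     first index. *)
  apply: (mulgI c); rewrite mulKVg -expgS -{2}(ord_predK i) /=.
  by rewrite expg_mod.
apply/seteqP; split=> [_ [_ [x /= Mx <-] <-]|_ [y /= My <-]].
  exists (t^-1%g x); first exact: stM.
  by apply/esym/shift_minkowskiP => i; exact: tV.
exists (minkowski iota s (t y)); first by exists (t y) => //; exact: stM.
apply/shift_minkowskiP => i; rewrite tV; last exact: stM.
by rewrite -(galMT t) mulgV gal_id.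
Qed.

End LatticeShift.

Theorem theorem3 (R : realType) (K : splittingFieldType rat)
    (iota : {rmorphism K -> R[i]}) (n : nat) (M : zmodClosed K) :
  galois 1 {:K} ->
  \dim {:K} = n ->
  finitely_generated M ->
  (exists s : n.-tuple (gal_of {:K}),
     gal_ordering s /\
     cyclic_lattice [set minkowski iota s x | x in [set` M]])
  <-> cyclic_group_of_maps (gal_restr_set M).
Proof.
move=> galK dimK _; rewrite cyclic_group_of_mapsP.
split=> [[s [sord cycL]]|[stM cycM]].
  exact: cyclic_lattice_cyclic_quotient cycL.
apply: cyclic_quotient_cyclic_lattice => //.
(* As K is Galois over the rationals, G has exactly [n] elements. *)
by rewrite -gal_setT -galois_dim // dimv1 divn1.
Qed.
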